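(* Let $q$ be an odd prime power and let $\mathcal{A}$, $\mathcal{B}$ be the line sets of $\mathrm{PG}(3,q)$ defined in the context. Let $\mathcal{L}$ be a Cameron--Liebler line class of $\mathrm{PG}(3,q)$ with parameter $(q^2+1)/2$ such that $\mathcal{A}\subset\mathcal{L}$ and $\mathcal{B}\cap\mathcal{L}=\emptyset$. Then $\bar{\mathcal{L}}=(\mathcal{L}\setminus\mathcal{A})\cup\mathcal{B}$ is a Cameron--Liebler line class with parameter $(q^2+1)/2$.
   Context: A Cameron--Liebler line class of $\mathrm{PG}(3,q)$ with parameter $x$ is a set of lines such that every line spread of $\mathrm{PG}(3,q)$ contains exactly $x$ of its lines. Let $q$ be a power of an odd prime, with homogeneous coordinates $(X_1,X_2,X_3,X_4)$ on $\mathrm{PG}(3,q)$. Fix a non-square $\omega\in\mathrm{GF}(q)$. For $\lambda\in\mathrm{GF}(q)$ let $\mathcal{E}_\lambda$ be the elliptic quadric $X_1^2-\omega X_2^2+\lambda X_4^2+X_3X_4=0$, and let $\mathcal{E}=\mathcal{E}_0$, with quadratic form $Q(X)=X_1^2-\omega X_2^2+X_3X_4$. Let $\mathcal{L}_2$ be the set of lines meeting $\mathcal{E}$ in $2$ points (secant lines) and $\mathcal{L}_3$ the set of lines disjoint from $\mathcal{E}$ (external lines). Let $\pi$ be the plane $X_4=0$, and $\pi_0$ (resp. $\pi_1$) the set of points $X\in\pi$ with $Q(X)$ a non-zero square (resp. a non-square). Fix a non-zero square $\lambda_1$ and a non-square $\lambda_2$ in $\mathrm{GF}(q)$. Define $\mathcal{T}_{10}=\{r\in\mathcal{L}_2: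 |r\cap\mathcal{E}_{\lambda_1}|=1,\ |r\cap\pi_0|=1\}$, $\mathcal{T}_{11}=\{r\in\mathcal{L}_3: |r\cap\mathcal{E}_{\lambda_1}|=1,\ |r\cap\pi_1|=1\}$, $\mathcal{T}_{20}=\{r\in\mathcal{L}_3: |r\cap\mathcal{E}_{\lambda_2}|=1,\ |r\cap\pi_0|=1\}$, $\mathcal{T}_{21}=\{r\in\mathcal{L}_2: |r\cap\mathcal{E}_{\lambda_2}|=1,\ |r\cap\pi_1|=1\}$, and $\mathcal{A}=\mathcal{T}_{11}\cup\mathcal{T}_{20}$, $\mathcal{B}=\mathcal{T}_{10}\cup\mathcal{T}_{21}$. *)

(* Defs.v *)
From HB Require Import structures.
From mathcomp Require Import all_boot all_order all_algebra all_field.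

Set Implicit Arguments.
Unset Strict Implicit.
Unset Printing Implicit Defensive.

Import GRing.Theory VectorInternalTheory.
Local Open Scope ring_scope.

(* The library equips {vspace vT} with a choiceType structure only. *)
HB.instance Definition _ (F : finFieldType) (vT : vectType F) :=
  [Finite of {vspace vT} by <:].

Section ProjectiveSpace.
Variable F : finFieldType.
Local Notation V := 'rV[F]_4.

(* PG(3, q), q = #|F|: points and lines are the subspaces of F^4 of vector
   space dimension 1 and 2; incidence is inclusion. *)
Definition pg_points : {set {vspace V}} := [set P | \dim P == 1%N].
Definition pg_lines : {set {vspace V}} := [set r | \dim r == 2].

Definition points_on (r : {vspace V}) : {set {vspace V}} :=
  [set P in pg_points | (P <= r)%VS].

Definition line_spread (S : {set {vspace V}}) : Prop :=
  S \subset pg_lines /\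
  forall P, P \in pg_points -> #|[set r in S | (P <= r)%VS]| = 1%N.

Definition cameron_liebler (x : nat) (L : {set {vspace V}}) : Prop :=
  L \subset pg_lines /\
  forall S, line_spread S -> #|S :&: L| = x.

Definition is_square (a : F) : bool := [exists b : F, a == b ^+ 2].

(* The points with homogeneous coordinates satisfying C; below, C is always
   invariant under multiplication by a non-zero scalar. The dimension of P
   forces v != 0. *)
Definition locus (C : pred V) : {set {vspace V}} :=
  [set P in pg_points | [exists v : V, (P == <[v]>%VS) && C v]].

(* X_1, X_2, X_3, X_4 are the entries of index 0, 1, 2, 3. *)
Definition Qform (w l : F) (v : V) : F :=
  v 0 0 ^+ 2 - w * v 0 1 ^+ 2 + l * v 0 3 ^+ 2 + v 0 2 * v 0 3.

Variable w : F.

Definition quadric (l : F) := locus (fun v => Qform w l v == 0).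

Definition secant_lines : {set {vspace V}} :=
  [set r in pg_lines | #|points_on r :&: quadric 0| == 2].
Definition external_lines : {set {vspace V}} :=
  [set r in pg_lines | points_on r :&: quadric 0 == set0].

Definition plane_pi0 :=
  locus (fun v => [&& v 0 3 == 0, Qform w 0 v != 0 & is_square (Qform w 0 v)]).
Definition plane_pi1 :=
  locus (fun v => (v 0 3 == 0) && ~~ is_square (Qform w 0 v)).

Definition tangent_meeting (l : F) (D : {set {vspace V}}) : pred {vspace V} :=
  fun r => (#|points_on r :&: quadric l| == 1%N) && (#|points_on r :&: D| == 1%N).

Definition T10 (l1 : F) := [set r in secant_lines | tangent_meeting l1 plane_pi0 r].
Definition T11 (l1 : F) := [set r in external_lines | tangent_meeting l1 plane_pi1 r].
Definition T20 (l2 : F) := [set r in external_lines | tangent_meeting l2 plane_pi0 r].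
Definition T21 (l2 : F) := [set r in secant_lines | tangent_meeting l2 plane_pi1 r].

Definition setA (l1 l2 : F) := T11 l1 :|: T20 l2.
Definition setB (l1 l2 : F) := T10 l1 :|: T21 l2.

End ProjectiveSpace.

(* Main.v *)
Require Import Defs.
From mathcomp Require Import all_boot all_order all_algebra all_field.
From mathcomp Require Import ring zify.

(* Let chi be the quadratic character of F, Q_l the form defining E_l, and
   g(v) = chi(Q_l2 v) - chi(Q_l1 v). The sum of chi(Q_l v) over a line r vanishes
   unless Q_l has rank one on r, that is, unless r is tangent to E_l, and the
   sign of a tangent line is read off at its point in the plane X_4 = 0, where
   Q_l1 = Q_l2. Hence the sum of g over r is q(q - 1) times the difference of
   the indicators of A and B at r. The lines of a spread S partition the nonzero
   vectors, so adding up over S gives q(q - 1)(|S :&: A| - |S :&: B|), which is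
   the sum of g over the whole space; that sum is zero since Q_l1 and Q_l2 are
   equivalent forms. Thus replacing A by B preserves every |S :&: L|. *)

Set Implicit Arguments.
Unset Strict Implicit.
Unset Printing Implicit Defensive.
Import Order.TTheory GRing.Theory Num.Theory.
Local Open Scope ring_scope.

(** * The quadratic character and its sums over polynomials of degree at most two *)

Section QuadraticCharacter.
Variable F : finFieldType.

Definition quadchar (c : F) : int :=
  if c == 0 then 0 else if is_square c then 1 else -1.

Lemma is_squareP (c : F) : reflect (exists b, c = b ^+ 2) (is_square c).
Proof. by apply: (iffP existsP) => -[b /eqP]; exists b => //; apply/eqP. Qed.

Lemma is_square_sqr (b : F) : is_square (b ^+ 2).
Proof. by apply/is_squareP; exists b. Qed.

Lemma is_square0 : is_square (0 : F).
Proof. by apply/is_squareP; exists 0; rewrite expr0n. Qed.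

Lemma is_squareMl (b c : F) : b != 0 -> is_square (b ^+ 2 * c) = is_square c.
Proof.
move=> b0; apply/is_squareP/is_squareP => -[d e]; last first.
  by exists (b * d); rewrite e exprMn.
exists (b^-1 * d); rewrite exprMn -e mulrA -exprMn mulVf // expr1n mul1r //.
Qed.

Lemma quadchar0 : quadchar 0 = 0.
Proof. by rewrite /quadchar eqxx. Qed.

Lemma quadchar_sqrMl (b c : F) : b != 0 -> quadchar (b ^+ 2 * c) = quadchar c.
Proof. by move=> b0; rewrite /quadchar mulf_eq0 sqrf_eq0 (negPf b0) /= is_squareMl. Qed.

Lemma quadchar_eq0 (c : F) : (quadchar c == 0) = (c == 0).
Proof. by rewrite /quadchar; case: (eqVneq c 0) => // _; case: ifP. Qed.

Lemma quadchar_eq1 (c : F) : (quadchar c == 1) = (c != 0) && is_square c.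
Proof. by rewrite /quadchar; case: (eqVneq c 0) => // _; case: ifP. Qed.

Lemma quadchar_eqN1 (c : F) : (quadchar c == -1) = ~~ is_square c.
Proof.
rewrite /quadchar; case: (eqVneq c 0) => [->|_]; last by case: ifP.
by rewrite is_square0.
Qed.

(* In characteristic two, squaring is injective, hence every element is a square. *)
Lemma nonsquare_two_neq0 (w : F) : ~~ is_square w -> 2%:R != 0 :> F.
Proof.
apply: contraNneq => two0.
have sqr_inj : injective (fun x : F => x ^+ 2).
  move=> x y /eqP; rewrite -subr_eq0 => /eqP e.
  apply/eqP; rewrite -subr_eq0 -sqrf_eq0; apply/eqP.
  have -> : (x - y) ^+ 2 = (x ^+ 2 - y ^+ 2) + 2%:R * (y * (y - x)) by ring.
  by rewrite e two0 mul0r addr0.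
have [f _ fK] := injF_bij sqr_inj.
by apply/is_squareP; exists (f w); rewrite fK.
Qed.

Hypothesis two_neq0 : 2%:R != 0 :> F.

(** A root [b] of a nonzero square comes with [-b], which is distinct because 2 is nonzero. The
    count is cast to [int] because the character takes the value -1. *)
Lemma card_sqrt (c : F) : #|[set z : F | z ^+ 2 == c]|%:R = 1 + quadchar c.
Proof.
rewrite /quadchar; case: (eqVneq c 0) => [->|c0].
  have -> : [set z : F | z ^+ 2 == 0] = [set 0].
    by apply/setP => z; rewrite !inE sqrf_eq0.
  by rewrite cards1.
case: is_squareP => [[b e]|nsq]; last first.
  rewrite (_ : [set z | _] = set0) ?cards0 //.
  by apply/setP => z; rewrite !inE; apply/eqP => e; apply: nsq; exists z.
have -> : [set z : F | z ^+ 2 == c] = [set b; -b].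
  by apply/setP => z; rewrite !inE e eqf_sqr.
rewrite cards2 (_ : b != - b) //.
rewrite -subr_eq0 opprK -mulr2n -mulr_natl mulf_neq0 //.
by apply: contraNneq c0 => b0; rewrite e b0 expr0n.
Qed.

Lemma card_sqrtE (c : F) : \sum_(z : F) (z ^+ 2 == c)%:R = 1 + quadchar c.
Proof.
rewrite -card_sqrt -sum1_card natr_sum [RHS]big_mkcond /=.
by apply: eq_bigr => z _; rewrite inE; case: eqP.
Qed.

Lemma sum_quadchar : \sum_c quadchar c = 0.
Proof.
(* Double count of the pairs (c, z) with z^2 = c: each z determines c. *)
have : \sum_(c : F) \sum_(z : F) (z ^+ 2 == c)%:R = #|F|%:R :> int.
  rewrite exchange_big /= -sum1_card natr_sum; apply: eq_bigr => z _.
  by rewrite (bigD1 (z ^+ 2)) //= eqxx big1 ?addr0 // => c /negPf; rewrite eq_sym => ->.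
under eq_bigr do rewrite card_sqrtE.
by rewrite big_split /= sumr_const => /(canRL (addKr _)); rewrite addNr.
Qed.

(* The terms chi(c) + chi(n c) are all nonpositive for a non-square n, and they
   sum to zero. *)
Lemma quadcharM (b c : F) : quadchar (b * c) = quadchar b * quadchar c.
Proof.
have nonsq n d : ~~ is_square n -> quadchar (n * d) = - quadchar d.
  move=> nsq.
  have n0 : n != 0 by apply: contraNneq nsq => ->; rewrite is_square0.
  have le0 e : quadchar e + quadchar (n * e) <= 0.
    rewrite {1}/quadchar; case: (eqVneq e 0) => [->|e0]; first by rewrite mulr0 quadchar0.
    case: is_squareP => [[f ef]|_].
      have /eqP-> : quadchar (n * e) == -1 by
        rewrite quadchar_eqN1 ef mulrC is_squareMl // -sqrf_eq0 -ef.
      by [].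
    by rewrite /quadchar; case: ifP => // _; case: ifP.
  have sum0 : \sum_e (- (quadchar e + quadchar (n * e))) = 0.
    rewrite sumrN big_split /= sum_quadchar add0r.
    rewrite -(reindex_inj (mulfI n0) (P := predT) (F := quadchar)) /= ?sum_quadchar //.
  have ge0 e : true -> 0 <= - (quadchar e + quadchar (n * e)) by rewrite oppr_ge0.
  have /eqP := psumr_eq0P ge0 sum0 (i := d) isT.
  by rewrite oppr_eq0 addrC addr_eq0 => /eqP.
have [->|b0] := eqVneq b 0; first by rewrite mul0r quadchar0 mul0r.
have [/is_squareP[e def_b]|nsq] := boolP (is_square b); last first.
  by rewrite nonsq // (_ : quadchar b = -1) ?mulN1r //; apply/eqP; rewrite quadchar_eqN1.
have /eqP-> : quadchar b == 1 by rewrite quadchar_eq1 b0 def_b is_square_sqr.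
by rewrite mul1r def_b quadchar_sqrMl // -sqrf_eq0 -def_b.
Qed.

(** The sum of 1 + chi(y^2 + d) counts the affine points of the hyperbola z^2 = y^2 + d. With z = y
    + u the equation becomes 2uy = d - u^2, which has one solution y for each u != 0 and none for u
    = 0, hence q - 1 points. *)
Lemma sum_quadchar_sqrD (d : F) : d != 0 -> \sum_y quadchar (y ^+ 2 + d) = -1.
Proof.
move=> d0.
have count : \sum_y (1 + quadchar (y ^+ 2 + d)) = #|F|%:R - 1.
  under eq_bigr => y _ do rewrite -card_sqrtE (reindex_inj (addrI y)).
  rewrite exchange_big (bigD1 0) //= big1 ?add0r => [|y _]; last first.
    by rewrite addr0 -subr_eq0 opprD addrA subrr add0r oppr_eq0 (negPf d0).
  rewrite (eq_bigr (fun=> 1)) => [|u u0].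
    by rewrite sumr_const cardC1 -subn1 natrB // (ltnW (finNzRing_gt1 F)).
  have u20 : 2%:R * u != 0 by rewrite mulf_neq0.
  rewrite (bigD1 ((d - u ^+ 2) / (2%:R * u))) //= big1 ?addr0 => [|y neq].
    rewrite (_ : (_ == _) = true) //; apply/eqP; field.
    by rewrite u0 two_neq0.
  rewrite (_ : (_ == _) = false) //; apply: contraNF neq => /eqP e.
  apply/eqP; apply: (mulIf u20); rewrite divfK //.
  have -> : d = (y ^+ 2 + d) - y ^+ 2 by ring.
  by rewrite -e; ring.
move: count; rewrite big_split /= sumr_const cardT -cardE => /(congr1 (fun z => z - #|F|%:R)).
by rewrite addrAC subrr add0r addrAC subrr add0r.
Qed.

(** If e = 0, each of the q - 1 nonzero y contributes chi(n); otherwise chi(n) factors out and the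
    previous sum applies with d = e / n. *)
Lemma sum_quadchar_quadratic (n e : F) : n != 0 ->
  \sum_y quadchar (n * y ^+ 2 + e) = quadchar n * ((e == 0)%:R * #|F|%:R - 1).
Proof.
move=> n0; have [->|e0] := eqVneq e 0.
  under eq_bigr do rewrite addr0 quadcharM.
  rewrite -mulr_sumr; congr (_ * _); rewrite mul1r.
  rewrite (bigD1 0) //= expr0n quadchar0 add0r (eq_bigr (fun=> 1)) => [|y y0].
    by rewrite sumr_const cardC1 -subn1 natrB // (ltnW (finNzRing_gt1 F)).
  by rewrite -[y ^+ 2]mulr1 quadchar_sqrMl //; apply/eqP;
    rewrite quadchar_eq1 oner_neq0 -(expr1n _ 2) is_square_sqr.
rewrite mul0r add0r -(sum_quadchar_sqrD (d := e / n)) ?mulf_neq0 ?invr_neq0 //.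
rewrite mulr_sumr; apply: eq_bigr => y _.
by rewrite -quadcharM; congr quadchar; field.
Qed.

Lemma sum_quadchar_affine (b c : F) : b != 0 -> \sum_y quadchar (b * y + c) = 0.
Proof.
move=> b0; rewrite -[RHS]sum_quadchar.
by rewrite [RHS](reindex_inj (inj_comp (addIr c) (mulfI b0))).
Qed.

End QuadraticCharacter.

(** * Points and vectors of a line, relative to the plane X_4 = 0 *)

Section LineSums.
Variable F : finFieldType.
Local Notation V := 'rV[F]_4.

(** Such an [f] descends to projective points. The codomain is left free so that both predicates and
    integer-valued functions are covered. *)
Definition scale_invariant (T : Type) (f : V -> T) :=
  forall c v, c != 0 -> f (c *: v) = f v.

Lemma vlineZ (c : F) (v : V) : c != 0 -> <[c *: v]>%VS = <[v]>%VS.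
Proof.
move=> c0; apply/eqP; rewrite eqEsubv -!memvE memvZ ?memv_line //=.
by rewrite -{1}[v](scalerK c0) memvZ ?memv_line.
Qed.

Lemma in_locus (C : pred V) v :
  scale_invariant C -> v != 0 -> (<[v]>%VS \in locus C) = C v.
Proof.
move=> CZ v0; rewrite !inE dim_vline v0 /=.
apply/existsP/idP => [[u /andP[/eqP def_v Cu]]|Cv]; last by exists v; rewrite eqxx.
have /vlineP[c def_c] : v \in <[u]>%VS by rewrite -def_v memv_line.
rewrite def_c CZ //; apply: contraNneq v0 => c0.
by rewrite def_c c0 scale0r.
Qed.

Section Frame.
Variables (r : {vspace V}) (p a : V).
Hypotheses (dim_r : \dim r = 2) (p_r : p \in r) (a_r : a \in r).
Hypotheses (p3 : p 0 3 = 1) (a3 : a 0 3 = 0) (a_neq0 : a != 0).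

Lemma coord3 x y : (x *: p + y *: a) 0 3 = x.
Proof. by rewrite !mxE p3 a3 mulr0 addr0 mulr1. Qed.

Lemma frame_span : r = (<[p]> + <[a]>)%VS.
Proof.
apply/esym/eqP; rewrite eqEdim subv_add -!memvE p_r a_r dim_r /=.
have p_neq0 : p != 0.
  by apply/eqP => p0; move/eqP: p3; rewrite p0 mxE eq_sym oner_eq0.
rewrite dimv_disjoint_sum ?dim_vline ?p_neq0 ?a_neq0 //.
apply/eqP; rewrite -subv0; apply/subvP => v; rewrite memv_cap memv0.
case/andP=> /vlineP[x ->] /vlineP[y /matrixP/(_ 0 3)].
by rewrite !mxE p3 a3 mulr1 mulr0 => ->; rewrite scale0r.
Qed.

Lemma mem_frame v : reflect (exists x y, v = x *: p + y *: a) (v \in r).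
Proof.
apply: (iffP idP) => [|[x [y ->]]]; last by rewrite memvD ?memvZ.
rewrite frame_span => /memv_addP[_ /vlineP[x ->] [_ /vlineP[y ->] ->]].
by exists x, y.
Qed.

Lemma frame_inj x y x' y' :
  x *: p + y *: a = x' *: p + y' *: a -> x = x' /\ y = y'.
Proof.
move=> e; have /matrixP/(_ 0 3) := e; rewrite !coord3 => xx'.
split=> //; move: e; rewrite xx' => /addrI/eqP.
by rewrite -subr_eq0 -scalerBl scaler_eq0 (negPf a_neq0) orbF subr_eq0 => /eqP.
Qed.

(** The q + 1 points of the line: [None] is its point in the plane X_4 = 0, and [Some y] ranges over
    the affine points, normalised to X_4 = 1. *)
Let point (o : option F) : V := if o is Some y then p + y *: a else a.

Lemma points_on_frame : points_on r = [set <[point o]>%VS | o : option F].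
Proof.
have affine y : p + y *: a = 1 *: p + y *: a by rewrite scale1r.
apply/setP => P; rewrite !inE; apply/andP/imsetP => [[/eqP dimP Pr]|[o _ ->]].
  have P0 : P != 0%VS by rewrite -dimv_eq0 dimP.
  have v0 : vpick P != 0 by rewrite vpick0.
  have defP : P = <[vpick P]>%VS.
    by apply/esym/eqP; rewrite eqEdim -memvE memv_pick dim_vline v0 dimP.
  have /mem_frame[x [y e]] : vpick P \in r by rewrite (subvP Pr) ?memv_pick.
  have [x0|x0] := eqVneq x 0.
    exists None; rewrite //= defP e x0 scale0r add0r vlineZ //.
    by apply: contraNneq v0 => y0; rewrite e x0 y0 !scale0r addr0.
  exists (Some (x^-1 * y)); rewrite //= defP e.
  by rewrite -[RHS](vlineZ _ x0) scalerDr scalerA mulVKf.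
have o_r : point o \in r by case: o => [y|] //=; rewrite memvD ?memvZ.
rewrite -memvE o_r dim_vline; split=> //.
case: o {o_r} => [y|] //=; last by rewrite a_neq0.
have [/matrixP/(_ 0 3)|//] := eqVneq (p + y *: a) 0.
by rewrite affine coord3 mxE => /eqP; rewrite oner_eq0.
Qed.

Lemma point_inj : injective (fun o => <[point o]>%VS).
Proof.
have affine y : p + y *: a = 1 *: p + y *: a by rewrite scale1r.
have infty : a = 0 *: p + 1 *: a by rewrite scale0r scale1r add0r.
have line_eq (u v : V) : <[u]>%VS = <[v]>%VS -> exists c, u = c *: v.
  by move=> e; apply/vlineP; rewrite -e memv_line.
move=> [y|] [z|] //= /line_eq[c]; rewrite ?affine.
- rewrite scalerDr !scalerA mulr1 => /frame_inj[<-].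
  by rewrite mul1r => ->.
- rewrite -[c *: a]add0r -(scale0r p) => /frame_inj[/eqP].
  by rewrite oner_eq0.
- rewrite {1}infty scalerDr !scalerA mulr1 => /frame_inj[<-].
  by rewrite mul0r => /eqP; rewrite oner_eq0.
Qed.

Lemma card_points_on_frame (C : pred V) : scale_invariant C ->
  #|points_on r :&: locus C| = (C a + #|[set y | C (p + y *: a)%R]|)%N.
Proof.
move=> CZ.
have point_neq0 o : point o != 0.
  case: o => [y|] //=; apply/eqP => /matrixP/(_ 0 3)/eqP.
  by rewrite -[p]scale1r coord3 mxE oner_eq0.
have -> : points_on r :&: locus C = [set <[point o]>%VS | o in [pred o | C (point o)]].
  rewrite points_on_frame; apply/setP => P; rewrite inE.
  apply/andP/imsetP => [[/imsetP[o _ ->]]|[o Co ->]].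
    by rewrite in_locus // => Co; exists o.
  by rewrite in_locus //; split=> //; apply: imset_f.
rewrite card_imset; last exact: point_inj.
rewrite (cardD1 None) inE; congr (_ + _)%N.
rewrite -(card_imset [set y | C (p + y *: a)] Some_inj); apply: eq_card => -[y|]; rewrite !inE.
  by rewrite mem_imset ?inE //; apply: Some_inj.
by apply/esym/imsetP => -[].
Qed.

(** The vectors of [r] are x p + y a. Those with x = 0 give the first sum; for each of the q - 1
    nonzero x, replacing y by xy and rescaling gives the same affine sum. *)
Lemma sum_frame (g : V -> int) : scale_invariant g ->
  \sum_(v in r) g v =
    \sum_y g (y *: a) + (#|F|%:R - 1) * \sum_y g (p + y *: a).
Proof.
move=> gZ.
have -> : \sum_(v in r) g v =
    \sum_(v in [set xy.1 *: p + xy.2 *: a | xy : F * F]) g v.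
  apply: eq_bigl => v; apply/mem_frame/imsetP => [[x [y ->]]|[[x y] _ ->]].
    by exists (x, y).
  by exists x, y.
rewrite big_imset => [|[x y] [x' y'] _ _ /= /frame_inj[-> ->] //] /=.
rewrite -(pair_bigA _ (fun x y => g (x *: p + y *: a))) //=.
rewrite (bigD1 0) //=; congr (_ + _).
  by apply: eq_bigr => y _; rewrite scale0r add0r.
rewrite (eq_bigr (fun=> \sum_y g (p + y *: a))) => [|x x0].
  by rewrite sumr_const cardC1 -subn1 -[LHS]mulr_natl natrB // (ltnW (finNzRing_gt1 F)).
rewrite (reindex_inj (mulfI x0)); apply: eq_bigr => y _.
by rewrite -scalerA -scalerDr gZ.
Qed.

End Frame.

Lemma line_frame (r : {vspace V}) : \dim r = 2 ->
  (forall v, v \in r -> v 0 3 = 0) \/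
  (exists p a, [/\ p \in r, a \in r, p 0 3 = 1, a 0 3 = 0 & a != 0]).
Proof.
move=> dim_r.
have [/forallP r3|/forallPn[v]] := boolP [forall v : V, (v \in r) ==> (v 0 3 == 0)].
  by left=> v v_r; apply/eqP; move: (r3 v); rewrite v_r.
rewrite negb_imply => /andP[v_r v3]; right.
set p := (v 0 3)^-1 *: v.
have p_r : p \in r by rewrite memvZ.
have p3 : p 0 3 = 1 by rewrite mxE mulVf.
have /subvPn[u u_r u_p] : ~~ (r <= <[p]>)%VS.
  by apply/negP => /dimvS; rewrite dim_r dim_vline; case: (p != 0).
(* The second vector is the projection of [u] along [p] to the plane X_4 = 0; it is nonzero since
   [u] is no multiple of [p]. *)
exists p, (u - u 0 3 *: p); split=> //; first by rewrite memvB ?memvZ.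
  by rewrite 3!mxE p3 mulr1 subrr.
by apply: contraNneq u_p => /eqP; rewrite subr_eq0 => /eqP->; rewrite memvZ ?memv_line.
Qed.

End LineSums.

(** * The forms Q_l and the function g *)

Section Quadrics.
Variables (F : finFieldType) (w l1 l2 : F).
Local Notation V := 'rV[F]_4.

Lemma QformZ l c (v : V) : Qform w l (c *: v) = c ^+ 2 * Qform w l v.
Proof. by rewrite /Qform !mxE; ring. Qed.

Lemma Qform_coord3_eq0 l (v : V) : v 0 3 = 0 -> Qform w l v = Qform w 0 v.
Proof. by move=> v3; rewrite /Qform v3; ring. Qed.

(** The bilinear form polar to Q_l, evaluated at vectors with X_4 equal to 1 and 0 respectively; its
    term in l then vanishes, so one formula serves every l. *)
Definition polar (p a : V) : F :=
  2%:R * (p 0 0 * a 0 0 - w * p 0 1 * a 0 1) + a 0 2.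

Lemma Qform_frame l (p a : V) y : p 0 3 = 1 -> a 0 3 = 0 ->
  Qform w l (p + y *: a) =
    Qform w 0 a * y ^+ 2 + polar p a * y + (Qform w 0 p + l).
Proof. by move=> p3 a3; rewrite /Qform /polar !mxE p3 a3; ring. Qed.

Lemma quadric_invariant l : scale_invariant (fun v => Qform w l v == 0).
Proof. by move=> c v c0; rewrite QformZ mulf_eq0 sqrf_eq0 (negPf c0). Qed.

Lemma pi0_invariant : scale_invariant
  (fun v => [&& v 0 3 == 0, Qform w 0 v != 0 & is_square (Qform w 0 v)]).
Proof.
by move=> c v c0; rewrite QformZ mxE !mulf_eq0 (negPf c0) is_squareMl.
Qed.

Lemma pi1_invariant :
  scale_invariant (fun v => (v 0 3 == 0) && ~~ is_square (Qform w 0 v)).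
Proof. by move=> c v c0; rewrite QformZ mxE mulf_eq0 (negPf c0) is_squareMl. Qed.

(** The function g of the overview. *)
Definition quadchar_diff (v : V) : int :=
  quadchar (Qform w l2 v) - quadchar (Qform w l1 v).

Lemma quadchar_diff_invariant : scale_invariant quadchar_diff.
Proof. by move=> c v c0; rewrite /quadchar_diff !QformZ !quadchar_sqrMl. Qed.

Lemma quadchar_diff_coord3_eq0 (v : V) : v 0 3 = 0 -> quadchar_diff v = 0.
Proof.
by move=> v3; rewrite /quadchar_diff Qform_coord3_eq0 // (Qform_coord3_eq0 l1) // subrr.
Qed.

(* Q_l is Q_0 composed with the substitution X_3 -> X_3 + l X_4. *)
Lemma sum_quadchar_Qform l :
  \sum_(v : V) quadchar (Qform w l v) = \sum_(v : V) quadchar (Qform w 0 v).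
Proof.
pose shear (v : V) : V := v + (l * v 0 3) *: delta_mx 0 2.
have shear3 v : shear v 0 3 = v 0 3 by rewrite !mxE mulr0 addr0.
have shear_inj : injective shear.
  move=> u v e; have e3 : u 0 3 = v 0 3 by rewrite -shear3 e shear3.
  by move: e; rewrite /shear e3 => /addIr.
rewrite [RHS](reindex_inj shear_inj); apply: eq_bigr => v _.
by congr quadchar; rewrite /Qform shear3 !mxE /=; ring.
Qed.

Lemma sum_quadchar_diff : \sum_(v : V) quadchar_diff v = 0.
Proof. by rewrite sumrB !sum_quadchar_Qform subrr. Qed.

Lemma sum_spread S :
  line_spread S -> \sum_(r in S) \sum_(v in r) quadchar_diff v = 0.
Proof.
move=> [_ Spart]; rewrite -[RHS]sum_quadchar_diff.
under eq_bigr do rewrite big_mkcond.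
rewrite exchange_big; apply: eq_bigr => v _ /=.
(* The zero vector lies on every line of S but g vanishes there; a nonzero vector spans a point,
   which lies on exactly one line of S. *)
have [->|v0] := eqVneq v 0.
  by rewrite quadchar_diff_coord3_eq0 ?mxE // big1 // => r _; case: ifP.
rewrite -big_mkcondr sumr_const /=.
have /Spart : <[v]>%VS \in pg_points F by rewrite inE dim_vline v0.
by rewrite cardsE => ->.
Qed.

Hypotheses (w_nsq : ~~ is_square w) (l1_neq0 : l1 != 0) (l1_sq : is_square l1)
  (l2_nsq : ~~ is_square l2).

Let two_neq0 : 2%:R != 0 :> F := nonsquare_two_neq0 w_nsq.

(** If y were nonzero, x / y would be a square root of the non-square [w]. *)
Lemma norm_form_eq0 (x y : F) : x ^+ 2 - w * y ^+ 2 = 0 -> x = 0 /\ y = 0.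
Proof.
move=> /subr0_eq e.
suff y0 : y = 0 by split=> //; apply/eqP; rewrite -sqrf_eq0 e y0 expr0n mulr0.
apply: contraNeq w_nsq => y0; apply/is_squareP; exists (x / y).
by rewrite expr_div_n e mulfK // sqrf_eq0.
Qed.

(** * A line outside the plane X_4 = 0, which it meets in the point spanned by [a] *)

Section Line.
Variables (r : {vspace V}) (p a : V).
Hypotheses (dim_r : \dim r = 2) (p_r : p \in r) (a_r : a \in r).
Hypotheses (p3 : p 0 3 = 1) (a3 : a 0 3 = 0) (a_neq0 : a != 0).

Lemma affine_coord3 y : (p + y *: a) 0 3 = 1.
Proof. by rewrite !mxE p3 a3 mulr0 addr0. Qed.

Lemma sum_line : \sum_(v in r) quadchar_diff v =
  (#|F|%:R - 1) * \sum_y quadchar_diff (p + y *: a).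
Proof.
rewrite (sum_frame dim_r p_r a_r p3 a3 a_neq0 quadchar_diff_invariant).
rewrite big1 ?add0r // => y _.
by rewrite quadchar_diff_coord3_eq0 // mxE a3 mulr0.
Qed.

Lemma card_points_on_quadric l : #|points_on r :&: quadric w l| =
  ((Qform w 0 a == 0)%R + #|[set y | Qform w l (p + y *: a) == 0]%R|)%N.
Proof.
rewrite (card_points_on_frame dim_r p_r a_r p3 a3 a_neq0 (quadric_invariant l)).
by rewrite Qform_coord3_eq0.
Qed.

Lemma card_points_on_pi0 :
  #|points_on r :&: plane_pi0 w| = (quadchar (Qform w 0 a) == 1).
Proof.
rewrite (card_points_on_frame dim_r p_r a_r p3 a3 a_neq0 pi0_invariant).
rewrite a3 eqxx quadchar_eq1 (_ : [set y | _] = set0) ?cards0 ?addn0 //.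
by apply/setP => y; rewrite !inE affine_coord3 oner_eq0.
Qed.

Lemma card_points_on_pi1 :
  #|points_on r :&: plane_pi1 w| = (quadchar (Qform w 0 a) == -1).
Proof.
rewrite (card_points_on_frame dim_r p_r a_r p3 a3 a_neq0 pi1_invariant).
rewrite a3 eqxx quadchar_eqN1 (_ : [set y | _] = set0) ?cards0 ?addn0 //.
by apply/setP => y; rewrite !inE affine_coord3 oner_eq0.
Qed.

Section Isotropic.
Hypothesis Qa_eq0 : Qform w 0 a = 0.

(** On X_4 = 0 the form is X_1^2 - w X_2^2, which is anisotropic, so [a] is a nonzero multiple of
    (0,0,1,0) and the polar value is its third coordinate. *)
Lemma polar_isotropic_neq0 : polar p a != 0.
Proof.
have [a00 a01] : a 0 0 = 0 /\ a 0 1 = 0.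
  by apply: norm_form_eq0; move: Qa_eq0; rewrite /Qform a3; move=> <-; ring.
rewrite /polar a00 a01; apply: contraNneq a_neq0 => a02.
have a2 : a 0 2 = 0 by rewrite -a02; ring.
apply/eqP/rowP => i; rewrite mxE.
case: i => [[|[|[|[|//]]]] lti];
  [rewrite -[RHS]a00 | rewrite -[RHS]a01 | rewrite -[RHS]a2 | rewrite -[RHS]a3];
  by congr (a _ _); apply: val_inj.
Qed.

(** Both forms are affine functions of y with nonzero slope along the line, so both character sums
    vanish. *)
Lemma isotropic_sum : \sum_(v in r) quadchar_diff v = 0.
Proof.
rewrite sum_line; under eq_bigr do rewrite /quadchar_diff !Qform_frame // Qa_eq0 mul0r add0r.
by rewrite sumrB !sum_quadchar_affine ?polar_isotropic_neq0 // subrr mulr0.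
Qed.

(** The line meets each E_l in exactly two points: that of [a] and one affine point, the root of an
    affine function of y. *)
Lemma isotropic_not_tangent l D : ~~ tangent_meeting w l D r.
Proof.
rewrite /tangent_meeting card_points_on_quadric Qa_eq0 eqxx.
rewrite (_ : [set y | _] = [set - (Qform w 0 p + l) / polar p a]) ?cards1 //.
apply/setP => y; rewrite !inE Qform_frame // Qa_eq0 mul0r add0r addr_eq0.
by rewrite -(can2_eq (mulfK _) (divfK _)) ?polar_isotropic_neq0 // mulrC.
Qed.

End Isotropic.

Section Anisotropic.
Hypotheses (Qa_neq0 : Qform w 0 a != 0) (polar0 : polar p a = 0).

(** Without linear term, Q_l(p + y a) = Q_0(a) y^2 + (Q_0(p) + l). In the difference of the two
    quadratic sums the terms -1 cancel, and only the indicators of tangency remain. *)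
Lemma anisotropic_sum : \sum_(v in r) quadchar_diff v =
  (#|F|%:R - 1) * #|F|%:R * (quadchar (Qform w 0 a) *
    ((Qform w 0 p + l2 == 0)%:R - (Qform w 0 p + l1 == 0)%:R)).
Proof.
rewrite sum_line; under eq_bigr do
  rewrite /quadchar_diff !Qform_frame // polar0 mul0r addr0.
by rewrite sumrB !sum_quadchar_quadratic //; ring.
Qed.

Lemma anisotropic_card l : #|points_on r :&: quadric w l|%:R =
  1 + quadchar (- (Qform w 0 a * (Qform w 0 p + l))).
Proof.
rewrite card_points_on_quadric (negPf Qa_neq0) add0n.
rewrite (_ : [set y | _] = [set y | y ^+ 2 == - (Qform w 0 p + l) / Qform w 0 a]).
  rewrite card_sqrt // -[in RHS](quadchar_sqrMl _ (invr_neq0 Qa_neq0)).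
  by congr (1 + quadchar _); field.
apply/setP => y; rewrite !inE Qform_frame // polar0 mul0r addr0 addr_eq0.
by rewrite -(can2_eq (mulfK _) (divfK _)) // mulrC.
Qed.

Lemma anisotropic_tangent l D : tangent_meeting w l D r =
  (Qform w 0 p + l == 0) && (#|points_on r :&: D| == 1%N).
Proof.
rewrite /tangent_meeting -(eqr_nat int) anisotropic_card -subr_eq0 addrAC subrr add0r.
by rewrite quadchar_eq0 oppr_eq0 mulf_eq0 (negPf Qa_neq0).
Qed.

(** Tangency to E_l means Q_0(p) = -l, so the line meets E = E_0 in 1 + chi(Q_0(a) l) points. *)
Lemma tangent_secant l : Qform w 0 p + l = 0 ->
  (r \in secant_lines w) = (quadchar (Qform w 0 a) * quadchar l == 1).
Proof.
move=> /eqP; rewrite addr_eq0 => /eqP Cl.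
rewrite !inE dim_r eqxx -(eqr_nat int) anisotropic_card Cl.
rewrite (_ : - (_ * _) = Qform w 0 a * l); last by ring.
by rewrite quadcharM //; move: (_ * _) => c; apply/eqP/eqP; lia.
Qed.

Lemma tangent_external l : Qform w 0 p + l = 0 ->
  (r \in external_lines w) = (quadchar (Qform w 0 a) * quadchar l == -1).
Proof.
move=> /eqP; rewrite addr_eq0 => /eqP Cl.
rewrite !inE dim_r eqxx -cards_eq0 -(eqr_nat int) anisotropic_card Cl.
rewrite (_ : - (_ * _) = Qform w 0 a * l); last by ring.
by rewrite quadcharM //; move: (_ * _) => c; apply/eqP/eqP; lia.
Qed.

(** Let s = chi(Q_0(a)): s = 1 puts the point of [a] in pi_0, and s = -1 in pi_1. A tangent to E_l1
    is secant to E iff s = 1, so it lies in T10 or T11 and contributes -s. A tangent to E_l2 is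
    secant iff s = -1, so it lies in T20 or T21 and contributes s. Both tangencies at once would
    force l1 = l2. *)
Lemma anisotropic_indicator :
  (r \in setA w l1 l2)%:R - (r \in setB w l1 l2)%:R =
  quadchar (Qform w 0 a) *
    ((Qform w 0 p + l2 == 0)%:R - (Qform w 0 p + l1 == 0)%:R).
Proof.
have chi1 : quadchar l1 = 1 by apply/eqP; rewrite quadchar_eq1 l1_neq0.
have chi2 : quadchar l2 = -1 by apply/eqP; rewrite quadchar_eqN1.
have l12 : l1 != l2 by apply: contraNneq l2_nsq => <-.
have chiN : quadchar (Qform w 0 a) = 1 \/ quadchar (Qform w 0 a) = -1.
  by rewrite /quadchar (negPf Qa_neq0); case: ifP; [left|right].
rewrite /setA /setB !in_setU.
have -> : (r \in T10 w l1) = (r \in secant_lines w) && tangent_meeting w l1 (plane_pi0 w) r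
  by rewrite [LHS]in_set.
have -> : (r \in T11 w l1) = (r \in external_lines w) && tangent_meeting w l1 (plane_pi1 w) r
  by rewrite [LHS]in_set.
have -> : (r \in T20 w l2) = (r \in external_lines w) && tangent_meeting w l2 (plane_pi0 w) r
  by rewrite [LHS]in_set.
have -> : (r \in T21 w l2) = (r \in secant_lines w) && tangent_meeting w l2 (plane_pi1 w) r
  by rewrite [LHS]in_set.
rewrite !anisotropic_tangent card_points_on_pi0 card_points_on_pi1.
have [C1|C1] := eqVneq (Qform w 0 p + l1) 0.
  have C2 : Qform w 0 p + l2 != 0.
    by apply: contraNneq l12 => C2; apply/eqP/(addrI (Qform w 0 p)); rewrite C1 C2.
  rewrite (negPf C2) (tangent_secant C1) (tangent_external C1) chi1.
  by case: chiN => ->.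
have [C2|C2] := eqVneq (Qform w 0 p + l2) 0; last by rewrite /= !andbF /= mulr0.
rewrite (tangent_secant C2) (tangent_external C2) chi2.
by case: chiN => ->.
Qed.

End Anisotropic.
End Line.

(** * From single lines to spreads *)

Lemma tangent_memU (r : {vspace V}) :
  r \in setA w l1 l2 :|: setB w l1 l2 ->
  exists l D, tangent_meeting w l D r.
Proof.
rewrite !inE; case/orP => /orP[] /andP[_ h];
  by [exists l1, (plane_pi0 w) | exists l1, (plane_pi1 w)
     | exists l2, (plane_pi0 w) | exists l2, (plane_pi1 w)].
Qed.

(** All the quadrics E_l have the same points in the plane X_4 = 0, so a line there cannot meet some
    E_l in one point and E in two or none. *)
Lemma plane_line_notin (r : {vspace V}) :
  (forall v, v \in r -> v 0 3 = 0) -> r \notin setA w l1 l2 :|: setB w l1 l2.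
Proof.
move=> r3.
have same l : points_on r :&: quadric w l = points_on r :&: quadric w 0.
  apply/setP => P; rewrite !inE; case: eqP => //= dimP; case: (boolP (P <= r)%VS) => //= Pr.
  apply: eq_existsb => v; case: eqP => //= defP.
  by rewrite Qform_coord3_eq0 // r3 // memvE -defP.
rewrite !inE /tangent_meeting !same -cards_eq0.
by case: #|_ :&: quadric w 0| => [|[|[|n]]]; rewrite ?andbF.
Qed.

(** Both sides vanish when the line lies in X_4 = 0 or meets that plane in an isotropic point; every
    other line reduces to a frame with zero polar value. *)
Lemma sum_quadchar_diff_line (r : {vspace V}) : \dim r = 2 ->
  \sum_(v in r) quadchar_diff v =
  (#|F|%:R - 1) * #|F|%:R * ((r \in setA w l1 l2)%:R - (r \in setB w l1 l2)%:R).
Proof.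
move=> dim_r; have [r3|[p [a [p_r a_r p3 a3 a0]]]] := line_frame dim_r.
  rewrite big1 => [|v /r3]; last exact: quadchar_diff_coord3_eq0.
  have := plane_line_notin r3; rewrite in_setU negb_or => /andP[/negPf-> /negPf->].
  by rewrite subrr mulr0.
have [Qa0|Qa0] := eqVneq (Qform w 0 a) 0.
  rewrite (isotropic_sum dim_r p_r a_r p3 a3 a0 Qa0).
  have nU : r \notin setA w l1 l2 :|: setB w l1 l2.
    apply/negP => /tangent_memU[l [D]]; apply/negP.
    exact: (isotropic_not_tangent dim_r p_r a_r p3 a3 a0 Qa0).
  move: nU; rewrite in_setU negb_or => /andP[/negPf-> /negPf->].
  by rewrite subrr mulr0.
(* Complete the square: move the base point p to the vertex of the parabola. *)
pose t := - polar p a / (2%:R * Qform w 0 a).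
have p'_r : p + t *: a \in r by rewrite memvD ?memvZ.
have p'3 : (p + t *: a) 0 3 = 1 by rewrite !mxE p3 a3 mulr0 addr0.
have polar0 : polar (p + t *: a) a = 0.
  have -> : polar (p + t *: a) a = polar p a + t * (2%:R * Qform w 0 a).
    by rewrite /polar /Qform !mxE a3; ring.
  by rewrite divfK ?subrr // mulf_neq0.
rewrite (anisotropic_sum dim_r p'_r a_r p'3 a3 a0 Qa0 polar0).
by rewrite (anisotropic_indicator dim_r p'_r a_r p'3 a3 a0 Qa0 polar0).
Qed.

Lemma card_spread_setA S :
  line_spread S -> #|S :&: setA w l1 l2| = #|S :&: setB w l1 l2|.
Proof.
move=> spreadS; have [/subsetP Slines _] := spreadS.
have := sum_spread spreadS.
rewrite (eq_bigr (fun r => (#|F|%:R - 1) * #|F|%:R *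
    ((r \in setA w l1 l2)%:R - (r \in setB w l1 l2)%:R))); last first.
  by move=> r /Slines; rewrite inE => /eqP; apply: sum_quadchar_diff_line.
have indicator (X : {set {vspace V}}) : \sum_(r in S) (r \in X)%:R = #|S :&: X|%:R :> int.
  rewrite -sum1_card natr_sum [RHS]big_mkcond [LHS]big_mkcond; apply: eq_bigr => r _.
  by rewrite inE; case: (r \in S); case: (r \in X).
(* Needed to cancel the factor q(q - 1). *)
have q_gt1 := finNzRing_gt1 F.
rewrite -mulr_sumr sumrB !indicator => /eqP.
rewrite !mulf_eq0 !subr_eq0 pnatr_eq1 pnatr_eq0 eqr_nat.
by rewrite (gtn_eqF q_gt1) (gtn_eqF (ltnW q_gt1)) => /eqP.
Qed.

End Quadrics.

(** * Switching A and B in the line class *)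

Theorem theorem3p9 (F : finFieldType) (w l1 l2 : F)
    (L : {set {vspace 'rV[F]_4}}) :
  odd #|F| ->
  ~~ is_square w ->
  l1 != 0%R -> is_square l1 ->
  ~~ is_square l2 ->
  cameron_liebler ((#|F| ^ 2 + 1) %/ 2) L ->
  setA w l1 l2 \subset L ->
  setB w l1 l2 :&: L = set0 ->
  cameron_liebler ((#|F| ^ 2 + 1) %/ 2)
    ((L :\: setA w l1 l2) :|: setB w l1 l2).
Proof.
move=> _ w_nsq l1_neq0 l1_sq l2_nsq [Llines Lspread] AL BL; split.
  rewrite subUset (subset_trans (subsetDl _ _) Llines) /=.
  by apply/subsetP => r; rewrite !inE => /orP[] /andP[/andP[]].
move=> S spreadS; rewrite -(Lspread S spreadS) setIUr setIDA.
have AB := card_spread_setA w_nsq l1_neq0 l1_sq l2_nsq spreadS.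
(* The union is disjoint because B misses L. Since A lies in L, removing A then costs exactly |S :&:
   A| lines, which equals the |S :&: B| lines gained. *)
have -> : #|(S :&: L) :\: setA w l1 l2 :|: S :&: setB w l1 l2| =
    (#|(S :&: L) :\: setA w l1 l2| + #|S :&: setB w l1 l2|)%N.
  apply/eqP; rewrite (leq_card_setU _ _).2 -setI_eq0 -subset0.
  apply/subsetP => r /setIP[/setDP[/setIP[_ rL] _] /setIP[_ rB]].
  by rewrite -BL; apply/setIP.
by rewrite -AB -(cardsID (setA w l1 l2) (S :&: L)) -setIA (setIidPr AL) addnC.
Qed.
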